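(* Let $G$ be the wallpaper group of type p2mm, i.e. $G=\langle x,y,\rho,\sigma\mid (x,y),\ \rho^2,\ \sigma^2,\ (\rho,\sigma),\ x^\rho=x^{-1},\ y^\rho=y^{-1},\ x^\sigma=x,\ y^\sigma=y^{-1}\rangle$, and let $A=\langle x,y\rangle$. Let $\tau:G\to G$ be the map with $\tau(g)=g$ for $g\in A\cup A\rho\sigma$ and $\tau(g)=g^\sigma$ for $g\in A\rho\cup A\sigma$. Then the weak Cayley table group $\mathcal W(G)$ is generated by $\mathcal W_0(G)$ and $\tau$ (in particular $\tau\in\mathcal W(G)$).
   Context: Notation: $g^h=h^{-1}gh$, $(g,h)=g^{-1}h^{-1}gh$. For a group $G$, $\sim$ denotes conjugacy in $G$. The weak Cayley table group $\mathcal W(G)$ is the group (under composition) of all bijections $f:G\to G$ such that $f(g_1g_2)\sim f(g_1)f(g_2)$ for all $g_1,g_2\in G$. It contains $\operatorname{Aut}(G)$ and the inversion map $\iota:g\mapsto g^{-1}$; $\mathcal W_0(G)=\langle \operatorname{Aut}(G),\iota\rangle$. *)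

(* Defs.v *)
From HB Require Import structures.
From mathcomp Require Import all_boot.
From mathcomp Require Import boolp classical_sets.

Set Implicit Arguments.
Unset Strict Implicit.
Unset Printing Implicit Defensive.

Local Open Scope classical_set_scope.
Local Open Scope group_scope.

(* [groupType] is the structure of arbitrary, possibly infinite, groups, with
   x ^ y = y^-1 * (x * y) and [~ x, y] = x^-1 * (y^-1 * (x * y)). *)

Definition is_subgroup (G : groupType) (H : set G) : Prop :=
  [/\ H 1, forall a b, H a -> H b -> H (a * b) & forall a, H a -> H a^-1].

Definition subgroup_generated (G : groupType) (S : set G) : set G :=
  smallest (@is_subgroup G) S.

Definition right_coset (G : groupType) (A : set G) (g : G) : set G :=
  [set a * g | a in A].

Definition conjugate (G : groupType) (g h : G) : Prop := exists k : G, h = g ^ k.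

(* Subgroups of the symmetric group of T, as sets of functions. *)
Definition is_bijection_group (T : Type) (F : set (T -> T)) : Prop :=
  [/\ forall f, F f -> bijective f,
      F id,
      forall f g, F f -> F g -> F (f \o g) &
      forall f g, F f -> cancel f g -> cancel g f -> F g].

Definition bijection_group_generated (T : Type) (S : set (T -> T)) :
  set (T -> T) := smallest (@is_bijection_group T) S.

Definition weak_cayley_table_group (G : groupType) : set (G -> G) :=
  [set f | bijective f /\
           forall g1 g2 : G, conjugate (f (g1 * g2)) (f g1 * f g2)].

Definition automorphisms (G : groupType) : set (G -> G) :=
  [set f | bijective f /\ {morph f : g h / g * h}].

Arguments weak_cayley_table_group : clear implicits.
Arguments automorphisms : clear implicits.

(* The group W_0(G). *)
Definition trivial_weak_cayley_maps (G : groupType) : set (G -> G) :=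
  bijection_group_generated (automorphisms G `|` [set fun g : G => g^-1]).
Arguments trivial_weak_cayley_maps : clear implicits.

Definition p2mm_relations (G : groupType) (x y rho sigma : G) : Prop :=
  [/\ [~ x, y] = 1, rho ^+ 2 = 1, sigma ^+ 2 = 1 & [~ rho, sigma] = 1] /\
  [/\ x ^ rho = x^-1, y ^ rho = y^-1, x ^ sigma = x & y ^ sigma = y^-1].

(* G is the group presented by the generators x, y, rho, sigma and the relations
   above: it is generated by them, the relations hold, and every quadruple of
   elements of a group that satisfies the relations is the image of
   (x, y, rho, sigma) under a homomorphism. *)
Definition p2mm_presentation (G : groupType) (x y rho sigma : G) : Prop :=
  [/\ p2mm_relations x y rho sigma,
      subgroup_generated [set x; y; rho; sigma] = setT &
      forall (H : groupType) (x' y' rho' sigma' : H),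
        p2mm_relations x' y' rho' sigma' ->
        exists phi : G -> H,
          {morph phi : g h / g * h} /\
          [/\ phi x = x', phi y = y', phi rho = rho' & phi sigma = sigma']].

(* Main.v *)
(** G is the product of two infinite dihedral groups, <x, rho sigma> and
    <y, sigma>; elements of A are the pairs of rotations.  A weak Cayley table
    map f preserves A, because the elements of A are exactly those whose class
    is finite.  On A each coordinate p of f satisfies |p(u + v)| = |p(u) + p(v)|,
    hence is additive, and preservation of classes makes f|A a signed monomial
    matrix, the restriction of an automorphism.  If f is the identity on A, then
    f preserves each coset of A, and comparing products of two reflections shows
    that in each factor f acts on the reflections through an isometry of Z.  When
    both isometries are translations f is an automorphism; tau and its conjugate
    by the exchange of the factors reverse the orientation of one of them. *)
Require Import Defs.
From HB Require Import structures.
From mathcomp Require Import all_boot.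
From mathcomp Require Import boolp classical_sets.
From mathcomp Require Import ssralg ssrint zify.
Local Open Scope classical_set_scope.
Local Open Scope group_scope.

(** * Weak Cayley maps of an arbitrary group *)

Section WeakCayley.
Variables (G : groupType).
Implicit Types (g h k : G) (f : G -> G).

Lemma conjugate_refl g : conjugate g g.
Proof. by exists 1; rewrite conjg1. Qed.

Lemma conjugate_sym g h : conjugate g h -> conjugate h g.
Proof. by case=> k ->; exists k^-1; rewrite conjgK. Qed.

Lemma conjugate_trans h g k : conjugate g h -> conjugate h k -> conjugate g k.
Proof. by move=> [a ->] [b ->]; exists (a * b); rewrite conjgM. Qed.

Lemma conjugate_mulC g h : conjugate (g * h) (h * g).
Proof. by exists g; rewrite conjgE mulgA mulKg. Qed.

(** Two conjugate elements are the products uv and vu of the same pair, and f(uv) ~ f(u)f(v) ~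
    f(v)f(u) ~ f(vu). *)
Lemma weak_cayley_conjugate f g h :
  weak_cayley_table_group G f -> conjugate g h -> conjugate (f g) (f h).
Proof.
move=> [_ wf] [k ->]; apply: conjugate_sym; rewrite conjgE.
apply: conjugate_trans (wf _ _) _; apply: conjugate_trans (conjugate_mulC _ _) _.
by apply: conjugate_sym; rewrite -{1}[g](mulgK k).
Qed.

Lemma weak_cayley_comp f1 f2 :
  weak_cayley_table_group G f1 -> weak_cayley_table_group G f2 ->
  weak_cayley_table_group G (f1 \o f2).
Proof.
move=> w1 w2; split=> [|g h /=]; first exact: bij_comp w1.1 w2.1.
exact: conjugate_trans (weak_cayley_conjugate _ _ _ w1 (w2.2 g h)) (w1.2 _ _).
Qed.

Lemma automorphism_weak_cayley f :
  automorphisms G f -> weak_cayley_table_group G f.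
Proof. by case=> bf mf; split=> // g h; rewrite mf; apply: conjugate_refl. Qed.

Lemma inv_weak_cayley : weak_cayley_table_group G (fun g => g^-1).
Proof.
split=> [|g h]; first exact: inv_bij invgK.
by rewrite invgM; apply: conjugate_mulC.
Qed.

Lemma automorphism_inverse f f' :
  automorphisms G f -> cancel f f' -> cancel f' f -> automorphisms G f'.
Proof.
move=> [_ mf] fK f'K; split; first by exists f.
by move=> g h; rewrite -{1}(f'K g) -{1}(f'K h) -mf fK.
Qed.

(** Membership in [weak_cayley_table_group] says nothing directly about the inverse map; carrying a
    weak Cayley inverse along makes closure under inversion immediate. *)
Definition biweak (f : G -> G) : Prop := weak_cayley_table_group G f /\
  exists f', [/\ cancel f f', cancel f' f & weak_cayley_table_group G f'].

Lemma biweak_bijection_group : is_bijection_group [set f | biweak f].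
Proof.
split=> /=.
- by move=> f [[]].
- have wid : weak_cayley_table_group G id.
    by apply: automorphism_weak_cayley; split=> //; exists id.
  by split=> //; exists id.
- move=> f g [wf [f' [fK f'K wf']]] [wg [g' [gK g'K wg']]].
  split; first exact: weak_cayley_comp.
  exists (g' \o f'); split; [exact: can_comp|exact: can_comp|].
  exact: weak_cayley_comp.
- move=> f g [wf [f' [fK f'K wf']]] fK1 gK1.
  have -> : g = f' by apply: funext => z; rewrite -{1}(f'K z) fK1.
  by split=> //; exists f.
Qed.

Lemma trivial_weak_cayley_biweak :
  trivial_weak_cayley_maps G `<=` [set f | biweak f].
Proof.
apply: smallest_sub; first exact: biweak_bijection_group.
move=> f [af|->]; last first.
  split; first exact: inv_weak_cayley.
  by exists (fun g => g^-1); split; [exact: invgK|exact: invgK|exact: inv_weak_cayley].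
split; first exact: automorphism_weak_cayley.
case: (af) => -[f' fK f'K] _; exists f'; split=> //.
exact/automorphism_weak_cayley/(automorphism_inverse f).
Qed.

(** [smallest] is an intersection, whose members are bijective only if some bijection group contains
    [S]; the hypothesis makes the [biweak] maps such a group. *)
Lemma generated_bijection_group (S : set (G -> G)) :
  (forall f, S f -> biweak f) ->
  is_bijection_group (bijection_group_generated S).
Proof.
move=> SW; split.
- move=> f Hf; have := Hf [set f | biweak f].
  by case=> [|[]//]; split => //; exact: biweak_bijection_group.
- by move=> K [[_ K1 _ _] _].
- move=> f g Hf Hg K HK; case: (HK) => [[_ _ KM _] _].
  exact: KM (Hf K HK) (Hg K HK).
- move=> f g Hf fK gK K HK; case: (HK) => [[_ _ _ KV] _].
  exact: KV (Hf K HK) fK gK.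
Qed.

End WeakCayley.

(** * Integer powers and generated subgroups *)

Section IntegerPowers.
Variables (G : groupType).
Implicit Types (x y : G) (m n : int).

Definition zpow x m : G := match m with Posz n => x ^+ n | Negz n => x ^- n.+1 end.

Lemma zpowS x m : zpow x (m + 1)%R = zpow x m * x.
Proof.
case: m => [n|[|n]].
- have -> : (Posz n + 1 = Posz n.+1)%R by lia.
  exact: expgSr.
- by rewrite /= expg1 mulVg.
- have -> : (Negz n.+1 + 1 = Negz n)%R by lia.
  by rewrite /= [in RHS]expgS invgM mulgVK.
Qed.

Lemma zpowB1 x m : zpow x (m - 1)%R = zpow x m * x^-1.
Proof. by rewrite -{2}[m](GRing.subrK 1%R) zpowS mulgK. Qed.

Lemma zpowD x m n : zpow x (m + n)%R = zpow x m * zpow x n.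
Proof.
elim: n => [|n IH|n IH].
- by rewrite GRing.addr0 mulg1.
- by rewrite -addn1 PoszD GRing.addrA !zpowS IH mulgA.
- by rewrite -addn1 PoszD GRing.opprD GRing.addrA !zpowB1 IH mulgA.
Qed.

Lemma zpowN x m : zpow x (- m)%R = (zpow x m)^-1.
Proof.
by apply/esym/mulg1_eq; rewrite -zpowD GRing.addrN.
Qed.

Lemma commute_zpow x y m : commute y x -> commute y (zpow x m).
Proof.
by move=> cyx; case: m => n; [exact: commuteX|exact/commuteV/commuteX].
Qed.

Lemma zpow_conj x y m : (zpow x m) ^ y = zpow (x ^ y) m.
Proof. by case: m => n /=; rewrite ?conjVg conjXg. Qed.

Lemma zpowV x m : zpow x^-1 m = (zpow x m)^-1.
Proof. by case: m => n /=; rewrite expVgn. Qed.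

Lemma zpow_subgroup (H : set G) x m : is_subgroup H -> H x -> H (zpow x m).
Proof.
move=> [H1 HM HV] Hx.
have HX (k : nat) : H (x ^+ k) by elim: k => // k IH; rewrite expgS; apply: HM.
by case: m => n; [exact: HX|exact/HV/HX].
Qed.

Lemma subgroup_generated_subgroup (S : set G) :
  is_subgroup (subgroup_generated S).
Proof.
split=> [|a b Ha Hb|a Ha] H HS; case: (HS) => [[H1 HM HV] _] //.
- exact: HM (Ha H HS) (Hb H HS).
- exact: HV (Ha H HS).
Qed.

End IntegerPowers.
Arguments zpow {G} x m.

Lemma zpow_morph (G H : groupType) (f : G -> H) x m :
  {morph f : g h / g * h} -> f (zpow x m) = zpow (f x) m.
Proof.
move=> fM.
have f1 : f 1 = 1 by apply: (@mulgI _ (f 1)); rewrite -fM !mulg1.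
have fX n : f (x ^+ n) = f x ^+ n by elim: n => // n IH; rewrite !expgS fM IH.
case: m => n /=; first exact: fX.
by apply/esym/mulg1_eq; rewrite -fX -fM mulgV f1.
Qed.

(** * The infinite dihedral group and its square *)

Definition dihedral : Type := (int * bool)%type.
HB.instance Definition _ := Choice.on dihedral.

Definition signed (s : bool) (a : int) : int := (if s then - a else a)%R.

(* [(a, s)] stands for r^a t^s, where t is an involution inverting r. *)
Definition dmul (u v : dihedral) : dihedral :=
  ((u.1 + signed u.2 v.1)%R, u.2 (+) v.2).
Definition dinv (u : dihedral) : dihedral := ((- signed u.2 u.1)%R, u.2).
Definition dihedral_one : dihedral := (0%R, false).

Lemma dmulA : associative dmul.
Proof. by move=> [a []] [b []] [c []]; rewrite /dmul /=; congr pair; lia. Qed.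
Lemma dmul1 : left_id dihedral_one dmul.
Proof. by move=> [a s]; rewrite /dmul /=; congr pair; lia. Qed.
Lemma dmulr1 : right_id dihedral_one dmul.
Proof. by move=> [a []]; rewrite /dmul /=; congr pair; lia. Qed.
Lemma dmulV : left_inverse dihedral_one dinv dmul.
Proof. by move=> [a []]; rewrite /dmul /dinv /dihedral_one /=; congr pair; lia. Qed.
Lemma dmulrV : right_inverse dihedral_one dinv dmul.
Proof. by move=> [a []]; rewrite /dmul /dinv /dihedral_one /=; congr pair; lia. Qed.

HB.instance Definition _ :=
  isGroup.Build dihedral dmulA dmul1 dmulr1 dmulV dmulrV.

Definition dihedral2 : groupType := (dihedral * dihedral)%type.

Lemma dmulE (a b : int) (s t : bool) :
  ((a, s) : dihedral) * ((b, t) : dihedral) = ((a + signed s b)%R, s (+) t).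
Proof. by []. Qed.

Lemma dihedral2_mulE (u v : dihedral2) : u * v = (u.1 * v.1, u.2 * v.2).
Proof. by []. Qed.

(** The quotient by the rotations is abelian, and a rotation is conjugate only to itself and its
    inverse. *)
Lemma conjugate_dihedral (u v : dihedral) : conjugate u v ->
  v.2 = u.2 /\ (u.2 = false -> v.1 = u.1 \/ v.1 = (- u.1)%R).
Proof.
move=> [[c r] ->]; case: u => a s.
rewrite conjgE /mul /= /inv /= /dmul /dinv /=.
by case: s; case: r; split=> //= _; lia.
Qed.

Lemma conjugate_pair (H K : groupType) (u v : (H * K)%type) :
  conjugate u v -> conjugate u.1 v.1 /\ conjugate u.2 v.2.
Proof. by case=> k ->; split; [exists k.1|exists k.2]. Qed.

Lemma pair_conjugate (H K : groupType) (u v : (H * K)%type) :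
  conjugate u.1 v.1 -> conjugate u.2 v.2 -> conjugate u v.
Proof.
case: u v => [u1 u2] [v1 v2] /= [k1 ->] [k2 ->].
by exists (k1, k2).
Qed.

Definition swap (g : dihedral2) : dihedral2 := (g.2, g.1).

Lemma swapK : involutive swap. Proof. by case. Qed.

Lemma swap_automorphism : automorphisms dihedral2 swap.
Proof. by split=> //; exact: inv_bij swapK. Qed.

(** Carries statements proved for one factor over to the other. *)
Lemma swap_conj_weak_cayley F : weak_cayley_table_group dihedral2 F ->
  weak_cayley_table_group dihedral2 (swap \o F \o swap).
Proof.
have ws := automorphism_weak_cayley _ _ swap_automorphism.
by move=> wF; do 2! apply: weak_cayley_comp => //.
Qed.

(** * Preservation of the translation subgroup *)

Section WeakCayleyDihedral2.
Variable F : dihedral2 -> dihedral2.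
Hypothesis wF : weak_cayley_table_group dihedral2 F.
Implicit Types g h : dihedral2.

Lemma weak_cayley_fst g h :
  (F (g * h)).1.2 = (F g).1.2 (+) (F h).1.2 /\
  ((F (g * h)).1.2 = false ->
   ((F g).1.1 + signed (F g).1.2 (F h).1.1 = (F (g * h)).1.1 \/
    (F g).1.1 + signed (F g).1.2 (F h).1.1 = - (F (g * h)).1.1)%R).
Proof.
have [/conjugate_dihedral [e1 e2] _] := conjugate_pair _ _ _ _ (wF.2 g h).
by split.
Qed.

Lemma weak_cayley_snd g h :
  (F (g * h)).2.2 = (F g).2.2 (+) (F h).2.2 /\
  ((F (g * h)).2.2 = false ->
   ((F g).2.1 + signed (F g).2.2 (F h).2.1 = (F (g * h)).2.1 \/
    (F g).2.1 + signed (F g).2.2 (F h).2.1 = - (F (g * h)).2.1)%R).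
Proof.
have [_ /conjugate_dihedral [e1 e2]] := conjugate_pair _ _ _ _ (wF.2 g h).
by split.
Qed.

(* A conjugacy class of translations has at most four elements, whereas an
   element acting on the second factor by a reflection has infinitely many
   conjugates. *)
Lemma preimage_translation_snd g :
  (F g).1.2 = false -> (F g).2.2 = false -> g.2.2 = false.
Proof.
case: g => [[a s] [b [|]]] // F1 F2; exfalso.
(* Conjugating the reflection r^b t by r^k gives r^(b - 2k) t. *)
pose c (k : int) : dihedral2 := ((a, s), (b - (k + k), true))%R.
have cg k : conjugate (F ((a, s), (b, true))) (F (c k)).
  apply: weak_cayley_conjugate wF _.
  apply: pair_conjugate => /=; first exact: conjugate_refl.
  exists (k, false).
  by rewrite conjgE /mul /= /inv /= /dmul /dinv /=; congr pair; lia.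
move: F1 F2 cg; case: (F _) => [[p u] [q v]] /= -> -> cg.
(* Every conjugate of the translation (p, q) is in this list of four, while [r] collects five
   distinct ones. *)
pose l : seq dihedral2 :=
  [:: ((p, false), (q, false)); ((- p, false), (q, false));
      ((p, false), (- q, false)); ((- p, false), (- q, false))]%R.
pose r := [seq F (c (Posz k)) | k <- iota 0 5].
have ur : uniq r.
  rewrite map_inj_uniq ?iota_uniq // => i j /(bij_inj wF.1) [].
  by lia.
have : (size r <= size l)%N.
  apply: uniq_leq_size => // z /mapP [k _ ->].
  case/conjugate_pair: (cg (Posz k)).
  case: (F _) => [[p' u'] [q' v']].
  move=> /conjugate_dihedral /= [-> /(_ erefl) [|] ->].
    by move=> /conjugate_dihedral /= [-> /(_ erefl) [|] ->]; rewrite !inE eqxx ?orbT.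
  by move=> /conjugate_dihedral /= [-> /(_ erefl) [|] ->]; rewrite !inE eqxx ?orbT.
by [].
Qed.

End WeakCayleyDihedral2.

Lemma preimage_translation F g : weak_cayley_table_group dihedral2 F ->
  (F g).1.2 = false -> (F g).2.2 = false -> g.1.2 = false /\ g.2.2 = false.
Proof.
move=> wF F1 F2; split; last exact: preimage_translation_snd F1 F2.
by apply: (preimage_translation_snd _ (swap_conj_weak_cayley _ wF) (swap g));
  rewrite /= swapK.
Qed.

Section Translations.
Variable F : dihedral2 -> dihedral2.
Hypothesis wF : weak_cayley_table_group dihedral2 F.

(* F induces a homomorphism from G to the point group; the three classes outside
   A have nontrivial and pairwise distinct images, which forces A into the
   kernel. *)
Lemma image_translation (a b : int) :
  let u : dihedral2 := ((a, false), (b, false)) in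
  (F u).1.2 = false /\ (F u).2.2 = false.
Proof.
move=> u.
pose r1 : dihedral2 := ((0%R, true), (0%R, false)).
pose r2 : dihedral2 := ((0%R, false), (0%R, true)).
have K1 := preimage_translation F r1 wF.
have K2 := preimage_translation F r2 wF.
have K12 := preimage_translation F (r1 * r2) wF.
have U1 := preimage_translation F (u * r1) wF.
have U2 := preimage_translation F (u * r2) wF.
have U12 := preimage_translation F (u * (r1 * r2)) wF.
move: K1 K2 K12 U1 U2 U12.
(* Reflection types multiply, so only those of [F u], [F r1] and [F r2] remain: a finite check. *)
rewrite !(weak_cayley_fst F wF _ _).1 !(weak_cayley_snd F wF _ _).1 /=.
case: (F u) => [[? []] [? []]]; case: (F r1) => [[? []] [? []]];
case: (F r2) => [[? []] [? []]] //= K1 K2 K12 U1 U2 U12;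
by [case: K1|case: K2|case: K12|case: U1|case: U2|case: U12].
Qed.

End Translations.

(* If p (u + v) = - (p u + p v), expanding p u = p ((u + v) - v) and
   p v = p ((u + v) - u) shows that the sum p u + p v vanishes. *)
Lemma additive_up_to_sign (V : zmodType) (p : V -> int) :
  (forall u v, p (u + v) = p u + p v \/ p (u + v) = - (p u + p v))%R ->
  {morph p : u v / (u + v)%R}.
Proof.
move=> pD.
have p0 : p 0%R = 0%R by have := pD 0%R 0%R; rewrite GRing.addr0; lia.
have pN v : p (- v)%R = (- p v)%R.
  by have := pD v (- v)%R; rewrite GRing.addrN p0; lia.
move=> u v; have := pD u v.
have := pD (u + v)%R (- v)%R; rewrite GRing.addrK pN.
have := pD (u + v)%R (- u)%R; rewrite GRing.addrAC GRing.addrN GRing.add0r pN.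
by lia.
Qed.

Lemma additive_int (f : int -> int) :
  {morph f : u v / (u + v)%R} -> forall m, f m = (f 1 * m)%R.
Proof.
move=> fD.
have f0 : f 0%R = 0%R by have := fD 0%R 0%R; rewrite GRing.addr0; lia.
have fS m : f (m + 1)%R = (f m + f 1)%R by exact: fD.
elim=> [|n IH|n IH]; first by rewrite f0; lia.
- have := fS (Posz n); have -> : (Posz n + 1 = Posz n.+1)%R by lia.
  by lia.
- have := fS (- (n.+1 : int))%R.
  have -> : (- (n.+1 : int) + 1 = - (n : int))%R by lia.
  by lia.
Qed.

(** * The action on translations *)

Section LinearPart.
Variable F : dihedral2 -> dihedral2.
Hypothesis wF : weak_cayley_table_group dihedral2 F.

Let p (u : int * int) : int := (F ((u.1, false), (u.2, false))).1.1.

(** Additivity up to sign makes the coordinate linear. The translations (1, 1) and (1, -1) are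
    conjugate, so alpha - beta = ±(alpha + beta), which forces one coefficient to vanish. *)
Lemma linear_part_fst : exists alpha beta : int,
  (alpha = 0 \/ beta = 0)%R /\
  forall a b : int, (F ((a, false), (b, false))).1.1 = (alpha * a + beta * b)%R.
Proof.
have pD : {morph p : u v / (u + v)%R}.
  apply: additive_up_to_sign => -[a b] [c d]; rewrite /p /=.
  have [_] := weak_cayley_fst F wF ((a, false), (b, false)) ((c, false), (d, false)).
  rewrite dihedral2_mulE !dmulE /=.
  have [-> _] := image_translation F wF (a + c)%R (b + d)%R.
  have [-> _] := image_translation F wF a b.
  by case/(_ erefl) => e; [left; rewrite -e|right; rewrite e GRing.opprK].
have pE a b : p (a, b) = (p (1, 0) * a + p (0, 1) * b)%R.
  have -> : (a, b) = ((a, 0) + (0, b))%R.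
    by apply: injective_projections => /=; rewrite ?GRing.addr0 ?GRing.add0r.
  rewrite pD; congr (_ + _)%R.
    apply: (additive_int (fun m => p (m, 0%R))) => u v.
    by rewrite -pD; congr (p _); congr pair.
  apply: (additive_int (fun m => p (0%R, m))) => u v.
  by rewrite -pD; congr (p _); congr pair.
exists (p (1, 0)%R), (p (0, 1)%R); split; last exact: pE.
have c : conjugate (((1%R, false), (1%R, false)) : dihedral2)
                   ((1%R, false), ((-1)%R, false)).
  apply: pair_conjugate; first exact: conjugate_refl.
  by exists (0%R, true).
have [/conjugate_dihedral [_] h _] := conjugate_pair _ _ _ _ (weak_cayley_conjugate _ _ _ _ wF c).
have := h (image_translation F wF 1 1).1.
rewrite -[_.1.1]/(p (1, -1)%R) -[(F ((1%R, false), (1%R, false))).1.1]/(p (1, 1)%R).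
rewrite (pE 1%R 1%R) (pE 1%R (-1)%R); lia.
Qed.

End LinearPart.

Lemma unit_int (a b : int) : (a * b = 1 -> a = 1 \/ a = -1)%R.
Proof.
move/(congr1 absz)/eqP; rewrite abszM muln_eq1 => /andP [/eqP a1 _]; lia.
Qed.

(** Each row of the matrix of [F] on A has a zero entry. Preimages of translations are translations,
    so the matrix is surjective, and the two remaining entries are units in different columns. *)
Lemma linear_part F : weak_cayley_table_group dihedral2 F ->
  exists (alpha delta : int) (e : bool),
  [/\ (alpha = 1 \/ alpha = -1)%R, (delta = 1 \/ delta = -1)%R &
  forall a b : int, F ((a, false), (b, false)) =
    let u : dihedral2 := (((alpha * a)%R, false), ((delta * b)%R, false)) in
    let v : dihedral2 := (((alpha * b)%R, false), ((delta * a)%R, false)) in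
    if e then v else u].
Proof.
move=> wF.
have [al [be [ab Fab]]] := linear_part_fst F wF.
have [de [ga [gd Fgd]]] := linear_part_fst _ (swap_conj_weak_cayley _ wF).
have FE a b : F ((a, false), (b, false)) =
    (((al * a + be * b)%R, false), ((ga * a + de * b)%R, false)).
  have := Fgd b a; rewrite /= /swap /=.
  have := Fab a b; have := image_translation F wF a b => /=.
  case: (F _) => [[? ?] [? ?]] /= [-> ->] -> ->.
  by congr (_, (_, _)); lia.
have surj m n : exists a b, [/\ al * a + be * b = m & ga * a + de * b = n]%R.
  have [F' _ F'K] := wF.1.
  have FK := F'K ((m, false), (n, false)).
  have := preimage_translation F (F' ((m, false), (n, false))) wF.
  rewrite FK /= => /(_ erefl erefl).
  case: (F' _) FK => [[a s] [b t]] /= FK [es et]; move: FK; rewrite es et FE.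
  by case=> e1 e2; exists a, b.
have [a1 [b1 [e1 e2]]] := surj 1%R 0%R.
have [a2 [b2 [e3 e4]]] := surj 0%R 1%R.
(* In the two mixed cases a column vanishes, against surjectivity. *)
case: ab gd => [al0|be0] [de0|ga0]; subst.
- exists be, ga, true; split; [apply: (unit_int _ b1); lia|apply: (unit_int _ a2); lia|].
  by move=> a b; rewrite FE /=; congr ((_, _), (_, _)); lia.
- by exfalso; nia.
- by exfalso; nia.
- exists al, de, false; split; [apply: (unit_int _ a1); lia|apply: (unit_int _ b2); lia|].
  by move=> a b; rewrite FE /=; congr ((_, _), (_, _)); lia.
Qed.

(** * Maps that fix every translation *)

Section TrivialLinearPart.
Variable F : dihedral2 -> dihedral2.
Hypothesis wF : weak_cayley_table_group dihedral2 F.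
Hypothesis Fid : forall a b : int,
  F ((a, false), (b, false)) = ((a, false), (b, false)).

(** The glide reflection [u * r] squares to the translation by 2 in the first factor. If [F r]
    reflected that factor, so would [F (u * r)], whose square is trivial there. Since [F r] is not a
    translation, it must reflect the second factor. *)
Lemma reflection_type :
  let r : dihedral2 := ((0%R, false), (0%R, true)) in
  (F r).1.2 = false /\ (F r).2.2 = true.
Proof.
move=> r.
have pre := preimage_translation F r wF.
pose u : dihedral2 := ((1%R, false), (0%R, false)).
have [t1 _] := weak_cayley_fst F wF u r.
have [] := weak_cayley_fst F wF (u * r) (u * r).
have -> : (u * r) * (u * r) = ((2%R, false), (0%R, false)) by [].
rewrite Fid t1 Fid /= => _ /(_ erefl).
move: pre; case: (F r) => [[? []] [? []]] //=; first by lia.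
- by move=> _ [] // e; exfalso; lia.
- by case.
Qed.

End TrivialLinearPart.

Lemma swap_conj_trivial_linear_part F :
  (forall a b : int, F ((a, false), (b, false)) = ((a, false), (b, false))) ->
  forall a b : int, (swap \o F \o swap) ((a, false), (b, false)) =
                    ((a, false), (b, false)).
Proof. by move=> Fid a b; rewrite /= Fid. Qed.

(** The type of [F g] is multiplicative in g, so a translation and one reflection of each factor
    determine it. *)
Lemma point_group_type F g : weak_cayley_table_group dihedral2 F ->
  (forall a b : int, F ((a, false), (b, false)) = ((a, false), (b, false))) ->
  (F g).1.2 = g.1.2 /\ (F g).2.2 = g.2.2.
Proof.
move=> wF Fid.
have [r21 r22] := reflection_type F wF Fid.
have /= [r12 r11] := reflection_type _ (swap_conj_weak_cayley _ wF)
  (swap_conj_trivial_linear_part _ Fid).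
case: g => [[a s] [b t]].
pose r1 : dihedral2 := ((0%R, s), (0%R, false)).
pose r2 : dihedral2 := ((0%R, false), (0%R, t)).
have -> : ((a, s), (b, t)) = (((a, false), (b, false)) : dihedral2) * (r1 * r2).
  rewrite /r1 /r2 !dihedral2_mulE !dmulE.
  by congr ((_, _), (_, _)); case: s t {r1 r2} => [] [] /=; lia.
rewrite !(weak_cayley_fst F wF _ _).1 !(weak_cayley_snd F wF _ _).1 Fid /=.
rewrite /r1 /r2; case: s t {r1 r2} => [] [];
  by rewrite ?Fid ?r21 ?r22 ?[(F _).1.2]r11 ?[(F _).2.2]r12.
Qed.

(** Two elements reflecting the first factor have a product rotating it, and [F] keeps the amount of
    that rotation. So the reflections of the first factor are moved by an isometry of Z,
    independently of the second factor. *)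
Lemma fst_affine F : weak_cayley_table_group dihedral2 F ->
  (forall a b : int, F ((a, false), (b, false)) = ((a, false), (b, false))) ->
  exists (theta : bool) (c : int), forall (a b : int) (s t : bool),
    (F ((a, s), (b, t))).1 =
    ((if s then c + signed theta a else a)%R, s).
Proof.
move=> wF Fid.
have ty1 g := (point_group_type F g wF Fid).1.
have ty2 g := (point_group_type F g wF Fid).2.
have rot a b t : (F ((a, false), (b, t))).1.1 = a.
  case: t; last by rewrite Fid.
  have h (a' b' c : int) :
      ((c + (F ((a', false), (b', true))).1.1 =
          (F ((c + a', false), (b', true))).1.1)%R \/
      (c + (F ((a', false), (b', true))).1.1 =
          - (F ((c + a', false), (b', true))).1.1)%R).
    have [_] := weak_cayley_fst F wF ((c, false), (0%R, false)) ((a', false), (b', true)).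
    rewrite dihedral2_mulE !dmulE /= GRing.add0r ty1 Fid /=.
    exact.
  (* This element is an involution, so twice the coordinate is zero; [h] with c = -a then reduces
     the general case to it. *)
  have h0 : (F ((0%R, false), (b, true))).1.1 = 0%R.
    pose r : dihedral2 := ((0%R, false), (b, true)).
    have [_] := weak_cayley_fst F wF r r.
    have -> : r * r = ((0%R, false), (0%R, false)).
      by congr ((_, _), (_, _)) => /=; lia.
    rewrite Fid !ty1 -/r /=.
    by move=> /(_ erefl); lia.
  have := h a b (- a)%R.
  by rewrite GRing.addNr h0; lia.
pose r (a : int) := (F ((a, true), (0%R, false))).1.1.
have refl (a a' b : int) t : ((F ((a, true), (b, t))).1.1 - r a' = a - a' \/
    (F ((a, true), (b, t))).1.1 - r a' = - (a - a'))%R.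
  have [_] := weak_cayley_fst F wF ((a, true), (b, t)) ((a', true), (0%R, false)).
  rewrite dihedral2_mulE !dmulE /= !ty1 /= rot -/(r a').
  exact.
(* Taking a' = a leaves the difference ±0. *)
have rE (a : int) b t : (F ((a, true), (b, t))).1.1 = r a.
  by have := refl a a b t; lia.
have rD (a a' : int) : (r a - r a' = a - a' \/ r a - r a' = - (a - a'))%R.
  by have := refl a a' 0%R false; rewrite rE.
(* An isometry of Z is determined by its values at 0 and 1; [th] records whether it reverses
   orientation. *)
have [th rth] : exists th, forall a, r a = (r 0 + signed th a)%R.
  have r10 := rD 1%R 0%R.
  exists (r 1 != r 0 + 1)%R => a; move: r10 (rD a 1%R) (rD a 0%R).
  by case: eqP => /=; lia.
exists th, (r 0%R) => a b s t.
move: (ty1 ((a, s), (b, t))) => /=.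
case: s => /=.
  by move: (rE a b t); case: (F _) => [[? ?] ?] /= -> ->; rewrite rth.
by move: (rot a b t); case: (F _) => [[? ?] ?] /= -> ->.
Qed.

(** * Automorphisms of the model and the model of [tau] *)

Definition dihedral_endo (c : int) (alpha : bool) (u : dihedral) : dihedral :=
  ((if u.2 then c + signed alpha u.1 else signed alpha u.1)%R, u.2).

(** The map is the endomorphism r -> r^±1, t -> r^c t, with the minus sign when [alpha] is true. *)
Lemma dihedral_endo_morph c alpha :
  {morph dihedral_endo c alpha : u v / u * v}.
Proof.
move=> [a s] [b t]; rewrite /dihedral_endo dmulE /= dmulE.
by congr pair; case: s; case: t; case: alpha => /=; lia.
Qed.

Lemma dihedral_endo_bij c alpha : bijective (dihedral_endo c alpha).
Proof.
by exists (dihedral_endo (if alpha then c else - c)%R alpha) => -[a s];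
  rewrite /dihedral_endo /=; congr pair; case: s; case: alpha => /=; lia.
Qed.

Definition pair_map (f1 f2 : dihedral -> dihedral) (g : dihedral2) : dihedral2 :=
  (f1 g.1, f2 g.2).

Lemma pair_map_bij f1 f2 :
  bijective f1 -> bijective f2 -> bijective (pair_map f1 f2).
Proof.
move=> [g1 K1 K1'] [g2 K2 K2']; exists (pair_map g1 g2) => -[u v];
  by rewrite /pair_map /= ?K1 ?K2 ?K1' ?K2'.
Qed.

Lemma pair_map_automorphism c1 alpha1 c2 alpha2 :
  automorphisms dihedral2
    (pair_map (dihedral_endo c1 alpha1) (dihedral_endo c2 alpha2)).
Proof.
split; first by apply: pair_map_bij; apply: dihedral_endo_bij.
by move=> u v; rewrite /pair_map /= !dihedral_endo_morph.
Qed.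

Definition reflection_flip (u : dihedral) : dihedral := (signed u.2 u.1, u.2).
(** This is [tau] in the model: the elements outside A and Aρσ are those reflecting the second
    factor, and conjugation by σ turns r^b t into r^-b t there. *)
Definition flip_snd : dihedral2 -> dihedral2 := pair_map id reflection_flip.

(* On the dihedral group, [reflection_flip] is inversion followed by the
   automorphism negating the translation part. *)
Lemma flip_snd_weak_cayley : weak_cayley_table_group dihedral2 flip_snd.
Proof.
split.
  apply: pair_map_bij; first by exists id.
  by apply: inv_bij => -[a []]; rewrite /reflection_flip /= ?GRing.opprK.
move=> [u1 u2] [v1 v2]; apply: pair_conjugate; first exact: conjugate_refl.
have flipE w : reflection_flip w = dihedral_endo 0%R true w^-1.
  by case: w => a []; rewrite /reflection_flip /dihedral_endo /inv /= /dinv /=;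
    congr pair; lia.
rewrite /= !flipE invgM !dihedral_endo_morph; exact: conjugate_mulC.
Qed.

(** * Generation in the model *)

Section Generation.
Variable P : set (dihedral2 -> dihedral2).
Hypothesis P_aut : automorphisms dihedral2 `<=` P.
Hypothesis P_flip : P flip_snd.
Hypothesis P_comp : forall f g, P f -> P g -> P (f \o g).

Lemma generation_trivial_linear_part F : weak_cayley_table_group dihedral2 F ->
  (forall a b : int, F ((a, false), (b, false)) = ((a, false), (b, false))) ->
  P F.
Proof.
move=> wF Fid.
have [th1 [c1 F1]] := fst_affine F wF Fid.
have [th2 [c2 F2]] := fst_affine _ (swap_conj_weak_cayley _ wF)
  (swap_conj_trivial_linear_part _ Fid).
have P_id : P id by apply: P_aut; split=> //; exists id.
have P_swap := P_aut _ swap_automorphism.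
have P_if (b : bool) f : P f -> P (if b then f else id) by case: b.
(* The flips supply the orientations of the two isometries, the automorphism their translation
   parts. *)
have -> : F = pair_map (dihedral_endo c1 false) (dihedral_endo c2 false)
    \o ((if th2 then flip_snd else id) \o
        (if th1 then swap \o flip_snd \o swap else id)).
  apply: funext => -[[a s] [b t]].
  move: (F1 a b s t) (F2 b a t s) => /=.
  case: (F _) => u v /= -> ->.
  by congr pair; case: th1 th2 s t {F1 F2} => [] [] [] [].
apply: P_comp; first exact/P_aut/pair_map_automorphism.
apply: P_comp; first exact: P_if.
by apply: P_if; do 2! apply: P_comp => //.
Qed.

(** Composition with sign changes and [swap], all automorphisms, reduces to maps fixing A
    pointwise. *)
Lemma weak_cayley_generation : weak_cayley_table_group dihedral2 `<=` P.
Proof.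
have diag F (al de : int) : weak_cayley_table_group dihedral2 F ->
    (al = 1 \/ al = -1)%R -> (de = 1 \/ de = -1)%R ->
    (forall a b : int, F ((a, false), (b, false)) =
       (((al * a)%R, false), ((de * b)%R, false))) -> P F.
  move=> wF hal hde FE.
  (* [D] is an involution acting on A as [F] does, so [D \o F] fixes A. *)
  pose D := pair_map (dihedral_endo 0%R (al != 1%R)) (dihedral_endo 0%R (de != 1%R)).
  have aD : automorphisms dihedral2 D by exact: pair_map_automorphism.
  have DD g : D (D g) = g.
    case: g => [[a s] [b t]]; rewrite /D /pair_map /dihedral_endo /=.
    by congr ((_, _), (_, _)); case: s t (_ != _) => [] [] [] /=; lia.
  have -> : F = D \o (D \o F) by apply: funext => g /=; rewrite DD.
  apply: P_comp; first exact: P_aut.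
  apply: generation_trivial_linear_part.
    exact: weak_cayley_comp (automorphism_weak_cayley _ _ aD) wF.
  move=> a b /=; rewrite FE /D /pair_map /dihedral_endo /=.
  by case: hal hde => -> [] ->; congr ((_, _), (_, _)) => /=; lia.
move=> F wF; have [al [de [e [hal hde FE]]]] := linear_part F wF.
case: e FE => FE; last exact: diag hal hde FE.
(* An antidiagonal linear part becomes diagonal after [swap]. *)
have -> : F = (F \o swap) \o swap by apply: funext => g /=; rewrite swapK.
apply: P_comp; last exact/P_aut/swap_automorphism.
apply: diag hal hde _ => [|a b]; last by rewrite /= FE.
exact: weak_cayley_comp wF (automorphism_weak_cayley _ _ swap_automorphism).
Qed.

End Generation.

(** * Transport along an isomorphism *)

Section Transport.
Variables (G H : groupType) (e : H -> G) (d : G -> H).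
Hypotheses (eM : {morph e : u v / u * v}) (dM : {morph d : g h / g * h}).
Hypotheses (eK : cancel e d) (dK : cancel d e).

Lemma transport_bij f : bijective f -> bijective (e \o f \o d).
Proof.
move=> bf; apply: bij_comp; last by exists e.
by apply: bij_comp bf; exists d.
Qed.

Lemma morph_conjugate u v : conjugate u v -> conjugate (e u) (e v).
Proof.
case=> k ->; exists (e k); apply: (@mulgI _ (e k)).
by rewrite -eM !conjgE !mulVKg eM.
Qed.

Lemma transport_weak_cayley f :
  weak_cayley_table_group H f -> weak_cayley_table_group G (e \o f \o d).
Proof.
move=> [bf wf]; split=> [|g h /=]; first exact: transport_bij.
by rewrite dM -eM; apply: morph_conjugate.
Qed.

Lemma transport_automorphism f :
  automorphisms H f -> automorphisms G (e \o f \o d).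
Proof.
move=> [bf mf]; split=> [|g h /=]; first exact: transport_bij.
by rewrite dM mf eM.
Qed.

End Transport.

(** * The presented group as a product of dihedral groups *)

Lemma dihedral_hom (G : groupType) (r s : G) : s ^+ 2 = 1 -> r ^ s = r^-1 ->
  {morph (fun u : dihedral => zpow r u.1 * s ^+ u.2) : u v / u * v}.
Proof.
rewrite expg2 => s2 rs [a t] [b t']; rewrite dmulE /= zpowD -!mulgA.
congr (_ * _); rewrite !mulgA.
have sr m : s * zpow r m = zpow r (- m)%R * s.
  have sV : s^-1 = s by exact: mulg1_eq.
  by rewrite conjgCV sV zpow_conj rs zpowV zpowN.
case: t => /=; last by rewrite !expg0 mul1g.
rewrite expg1 sr -mulgA. 
by case: t' => /=; rewrite ?expg0 ?expg1 ?s2 ?mulg1.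
Qed.

Lemma zpow_dihedral (a : int) : zpow ((1%R, false) : dihedral) a = (a, false).
Proof.
elim: a => [//|n IH|n IH].
- have -> : Posz n.+1 = (Posz n + 1)%R by lia.
  by rewrite zpowS IH.
- have -> : (- Posz n.+1 = - Posz n - 1)%R by lia.
  by rewrite zpowB1 IH.
Qed.

Section Presentation.
Variables (G : groupType) (x y rho sigma : G).
Hypothesis hG : p2mm_presentation x y rho sigma.

Let Mx : dihedral2 := ((1%R, false), 1).
Let My : dihedral2 := (1, (1%R, false)).
(** ρ = (ρσ)σ reflects both factors. *)
Let Mrho : dihedral2 := ((0%R, true), (0%R, true)).
Let Msigma : dihedral2 := (1, (0%R, true)).

Definition p2mm_of_dihedral2 (u : dihedral2) : G :=
  zpow x u.1.1 * (rho * sigma) ^+ u.1.2 * (zpow y u.2.1 * sigma ^+ u.2.2).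
Local Notation psi := p2mm_of_dihedral2.

(** The generators of <x, ρσ> commute with those of <y, σ>; for instance ρ and σ both invert y, so
    ρσ centralizes it. *)
Lemma p2mm_commute : [/\ commute x y, commute sigma x,
  commute (rho * sigma) y & commute (rho * sigma) sigma].
Proof.
case: hG => [[[xy r2 s2 rs] [xr yr xs ys]] _ _].
have c_rs : commute rho sigma by apply/commgP/eqP.
split.
- exact/commgP/eqP.
- by apply/commute_sym; rewrite /commute conjgC xs.
- apply/commute_sym; rewrite /commute conjgC conjgM yr conjVg ys invgK //.
- by apply/commute_sym/commuteM => //; apply: commute_sym.
Qed.

Lemma p2mm_of_dihedral2_morph : {morph psi : u v / u * v}.
Proof.
case: hG => [[[xy r2 s2 rs] [xr yr xs ys]] _ _].
have [cxy csx cry crs] := p2mm_commute.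
have c_rs : commute rho sigma by apply/commgP/eqP.
have rs2 : (rho * sigma) ^+ 2 = 1.
  by rewrite expg2 -mulgA (mulgA sigma) -c_rs !mulgA -expg2 r2 mul1g -expg2 s2.
have xrs : x ^ (rho * sigma) = x^-1 by rewrite conjgM xr conjVg xs.
move=> [u1 v1] [u2 v2]; rewrite /psi dihedral2_mulE.
rewrite (dihedral_hom G x (rho * sigma) rs2 xrs).
rewrite (dihedral_hom G y sigma s2 ys) /= -!mulgA; congr (_ * (_ * _)).
rewrite !mulgA; congr (_ * _); congr (_ * _).
rewrite -!mulgA.
have c1 m n : commute (zpow x m) (zpow y n).
  exact/commute_zpow/commute_sym/commute_zpow/commute_sym.
have c2 m (t : bool) : commute (zpow x m) (sigma ^+ t).
  exact/commuteX/commute_sym/commute_zpow.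
have c3 (t : bool) n : commute ((rho * sigma) ^+ t) (zpow y n).
  exact/commute_zpow/commute_sym/commuteX/commute_sym.
have c4 (t t' : bool) : commute ((rho * sigma) ^+ t) (sigma ^+ t').
  exact/commuteX2.
(* Each factor being handled by [dihedral_hom], it remains to exchange two elements of different
   factors. *)
suff : commute (zpow x u2.1 * (rho * sigma) ^+ u2.2)
               (zpow y v1.1 * sigma ^+ v1.2) by rewrite /commute -!mulgA.
apply: commuteM; apply/commute_sym/commuteM; apply/commute_sym => //.
Qed.

Lemma p2mm_dihedral2_generators : [/\ psi Mx = x, psi My = y,
  psi Mrho = rho & psi Msigma = sigma].
Proof.
case: hG => [[[xy r2 s2 rs] _] _ _].
split; rewrite /psi /= ?expg0 ?expg1 ?mulg1 ?mul1g //.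
by rewrite -mulgA -expg2 s2 mulg1.
Qed.

Lemma p2mm_of_dihedral2_surj g : exists u, psi u = g.
Proof.
have [e1 e2 e3 e4] := p2mm_dihedral2_generators.
have psiM := p2mm_of_dihedral2_morph.
case: hG => _ gen _.
have : subgroup_generated [set x; y; rho; sigma] g by rewrite gen.
move/(_ [set g | exists u, psi u = g]); apply; split; last first.
  by move=> _ [[[->|->]|->]|->]; [exists Mx|exists My|exists Mrho|exists Msigma].
have psi1 : psi 1 = 1 by apply: (@mulgI _ (psi 1)); rewrite -psiM !mulg1.
split=> [|_ _ [u <-] [v <-]|_ [u <-]]; first by exists 1.
- by exists (u * v).
- by exists u^-1; apply/esym/mulg1_eq; rewrite -psiM mulgV.
Qed.

(** Surjectivity of [psi] gives each element a normal form; the map [phi] from the universal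
    property recovers its exponents, so it is unique. *)
Lemma p2mm_dihedral2_iso : exists phi : G -> dihedral2,
  [/\ {morph phi : g h / g * h}, cancel psi phi & cancel phi psi].
Proof.
case: (hG) => _ _ /(_ dihedral2 Mx My Mrho Msigma) [|phi [phiM [px py pr ps]]].
  by [].
have psiK : cancel psi phi.
  move=> [[a s] [b t]]; rewrite /psi !phiM.
  have phi1 : phi 1 = 1 by apply: (@mulgI _ (phi 1)); rewrite -phiM !mulg1.
  have phib g (c : bool) : phi (g ^+ c) = phi g ^+ c by case: c; rewrite ?expg1.
  rewrite !(zpow_morph _ _ _ _ _ phiM) !phib phiM px py pr ps /=.
  (* Powers of [Mx] and [My] are computed inside a single factor, through its embedding. *)
  rewrite -(zpow_morph _ _ (fun u : dihedral => (u, 1) : dihedral2)); last first.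
    by move=> u v; rewrite dihedral2_mulE mulg1.
  rewrite -(zpow_morph _ _ (fun u : dihedral => (1, u) : dihedral2)); last first.
    by move=> u v; rewrite dihedral2_mulE mulg1.
  rewrite !zpow_dihedral.
  by case: s t => [] []; congr ((_, _), (_, _)) => /=; lia.
exists phi; split=> // g.
by have [u <-] := p2mm_of_dihedral2_surj g; rewrite psiK.
Qed.

Lemma p2mm_tau (tau : G -> G) :
  let A := subgroup_generated [set x; y] in
  (forall g, (A `|` right_coset A (rho * sigma)) g -> tau g = g) ->
  (forall g, (right_coset A rho `|` right_coset A sigma) g ->
     tau g = g ^ sigma) ->
  forall u, tau (psi u) = psi (flip_snd u).
Proof.
move=> A fixA conjA.
have [_ _ _ e4] := p2mm_dihedral2_generators.
have psiM := p2mm_of_dihedral2_morph.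
have [_ _ cry crs] := p2mm_commute.
case: hG => [[[xy r2 s2 rs] _] _ _].
have Aab a b : A (zpow x a * zpow y b).
  have sA : is_subgroup A by exact: subgroup_generated_subgroup.
  case: (sA) => _ AM _; apply: AM.
    by apply: zpow_subgroup sA _ => K [_ KS]; apply: KS; left.
  by apply: zpow_subgroup sA _ => K [_ KS]; apply: KS; right.
have cr b : rho * sigma * zpow y b = zpow y b * (rho * sigma).
  exact: commute_zpow.
(* The second reflection bit separates A and Aρσ from Aρ and Aσ. *)
move=> [[a s] [b []]]; last first.
  rewrite fixA /psi /= ?expg0 ?mulg1 //.
  case: s; rewrite ?expg0 ?expg1 ?mulg1; last by left; apply: Aab.
  right; exists (zpow x a * zpow y b) => //.
  by rewrite -!mulgA (mulgA rho) cr.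
rewrite conjA; last first.
  rewrite /psi /=; case: s; rewrite ?expg0 ?expg1 ?mulg1.
    left; exists (zpow x a * zpow y b) => //.
    by rewrite -!mulgA (mulgA rho) (mulgA (rho * sigma)) cr -!mulgA -expg2 s2 mulg1.
  by right; exists (zpow x a * zpow y b) => //; rewrite mulgA.
(* The equation g^σ = h is checked as gσ = σh, a product in the model on each side. *)
apply: (@mulgI _ sigma); rewrite conjgE mulVKg.
have L u : sigma * psi u = psi (Msigma * u) by rewrite psiM e4.
have R u : psi u * sigma = psi (u * Msigma) by rewrite psiM e4.
rewrite L R.
by congr psi; congr ((_, _), (_, _)); case: s => /=; lia.
Qed.

End Presentation.

Theorem mainTheorem6 (G : groupType) (x y rho sigma : G)
    (hG : p2mm_presentation x y rho sigma)
    (A : set G) (hA : A = subgroup_generated [set x; y])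
    (tau : G -> G)
    (htau_fix : forall g : G,
      (A `|` right_coset A (rho * sigma)) g -> tau g = g)
    (htau_conj : forall g : G,
      (right_coset A rho `|` right_coset A sigma) g -> tau g = g ^ sigma) :
  weak_cayley_table_group G tau /\
  weak_cayley_table_group G =
    bijection_group_generated (trivial_weak_cayley_maps G `|` [set tau]).
Proof.
subst A.
have psiM := p2mm_of_dihedral2_morph _ _ _ _ _ hG.
have [phi [phiM psiK phiK]] := p2mm_dihedral2_iso _ _ _ _ _ hG.
set psi := p2mm_of_dihedral2 _ _ _ _ _ in psiM psiK phiK.
have tau_psi : forall u, tau (psi u) = psi (flip_snd u).
  exact: p2mm_tau hG tau htau_fix htau_conj.
have tauE : psi \o flip_snd \o phi = tau.
  by apply: funext => g; rewrite /= -tau_psi phiK.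
have w_tau : weak_cayley_table_group G tau.
  rewrite -tauE; apply: transport_weak_cayley => //; exact: flip_snd_weak_cayley.
have tauK : involutive tau.
  move=> g; rewrite -(phiK g) !tau_psi; congr psi.
  by case: (phi g) => [[a s] [b []]]; congr (_, (_, _)) => /=; rewrite ?GRing.opprK.
have S_biweak f : (trivial_weak_cayley_maps G `|` [set tau]) f -> biweak G f.
  case=> [|->]; first exact: trivial_weak_cayley_biweak.
  by split=> //; exists tau.
split=> //; apply/seteqP; split=> f; last first.
  have sub : bijection_group_generated (trivial_weak_cayley_maps G `|` [set tau])
      `<=` [set f | biweak G f].
    apply: smallest_sub => //; exact: biweak_bijection_group.
  by case/sub.
move=> wf; set N := bijection_group_generated _.
have [_ _ N_comp _] : is_bijection_group N by exact: generated_bijection_group.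
have N_gen h : (trivial_weak_cayley_maps G `|` [set tau]) h -> N h.
  by move=> Sh K [_]; apply.
have -> : f = psi \o (phi \o f \o psi) \o phi.
  by apply: funext => g; rewrite /= !phiK.
(* Generation in the model is applied to the maps whose transport to [G] lies in the generated
   group. *)
apply: (weak_cayley_generation [set F | N (psi \o F \o phi)]) => /=.
- move=> F aF /=; apply: N_gen; left=> K [_]; apply; left.
  exact: transport_automorphism.
- by apply: N_gen; right; rewrite tauE.
- move=> F1 F2 N1 N2.
  have -> : psi \o (F1 \o F2) \o phi = (psi \o F1 \o phi) \o (psi \o F2 \o phi).
    by apply: funext => g; rewrite /= psiK.
  exact: N_comp.
- exact: transport_weak_cayley.
Qed.
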